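(* Let $\bm{x}^e:[0,1]^2\to\mathbb{R}^3$ be a rational Bézier patch with positive weights, and let $$N^e(\xi,\eta)=\sum_{r=0}^{m}\sum_{s=0}^{n}D^e_{rs}\,B_r^m(\xi)B_s^n(\eta)$$ be the Bernstein representation of the numerator of the Gram determinant associated with $\bm{x}^e$. Assume that $\bm{x}^e$ is regular on $[0,1]^2$ and that there exists a constant $\rho>0$ such that $N^e(\xi,\eta)\ge\rho$ for all $(\xi,\eta)\in[0,1]^2$. For each refinement level $\ell\in\mathbb{N}$, uniformly subdivide $[0,1]^2$ into $2^\ell\times 2^\ell$ subdomains, and for each subdomain, indexed by $\alpha$, let $$N^{e,\ell,\alpha}(\xi,\eta)=\sum_{r=0}^{m}\sum_{s=0}^{n}\widetilde D_{rs}^{e,\ell,\alpha}\,B_r^m(\xi)B_s^n(\eta)$$ be the Bernstein representation of the restriction of $N^e$ to that subdomain. Then there exists $\ell_0\in\mathbb{N}$ such that for every $\ell\ge\ell_0$, every subdomain $\alpha$ of level $\ell$, and every pair $(r,s)$ with $0\le r\le m$, $0\le s\le n$, $$\widetilde D_{rs}^{e,\ell,\alpha}>0.$$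
   Context: $B_i^k(t)=\binom{k}{i}t^i(1-t)^{k-i}$, $0\le i\le k$, denote the Bernstein polynomials of degree $k$. A rational Bézier patch of bi-degree $(p,q)$ is a map $\bm{x}^e=\mathbf{F}^e/W^e$ on $[0,1]^2$, where $\mathbf{F}^e$ is an $\mathbb{R}^3$-valued and $W^e$ a real-valued linear combination of the products $B_i^p(\xi)B_j^q(\eta)$; ''positive weights'' means that the Bernstein coefficients of $W^e$ are positive. Put $\mathbf{U}^e=\mathbf{F}^e_\xi W^e-\mathbf{F}^eW^e_\xi$ and $\mathbf{V}^e=\mathbf{F}^e_\eta W^e-\mathbf{F}^eW^e_\eta$. The numerator of the Gram determinant is the polynomial $N^e=(\mathbf{U}^e\cdot\mathbf{U}^e)(\mathbf{V}^e\cdot\mathbf{V}^e)-(\mathbf{U}^e\cdot\mathbf{V}^e)^2$; with $\bm{\mathcal{J}}^e=[\bm{x}^e_\xi\ \ \bm{x}^e_\eta]$ one has $\det((\bm{\mathcal{J}}^e)^\top\bm{\mathcal{J}}^e)=N^e/(W^e)^8$. It has degree at most $m=8p-2$ in $\xi$ and at most $n=8q-2$ in $\eta$. The patch is regular on a set if $\bm{\mathcal{J}}^e$ has rank $2$ at every point of the set. The Bernstein representation of the restriction of $N^e$ to a subdomain $[a,b]\times[c,d]$ means the Bernstein representation, of the same bi-degree $(m,n)$, of the polynomial $(\xi,\eta)\mapsto N^e(a+(b-a)\xi,\;c+(d-c)\eta)$ on $[0,1]^2$. At level $\ell$ the subdomains are the squares $[i2^{-\ell},(i+1)2^{-\ell}]\times[j2^{-\ell},(j+1)2^{-\ell}]$,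 $0\le i,j<2^\ell$. *)

(* Defs.v *)
From HB Require Import structures.
From mathcomp Require Import all_boot all_order all_algebra.
From mathcomp Require Import all_classical all_reals all_analysis.
Set Implicit Arguments.
Unset Strict Implicit.
Unset Printing Implicit Defensive.
Import Order.TTheory GRing.Theory Num.Theory.
Import numFieldNormedType.Exports.
Local Open Scope ring_scope.

Section Bezier.
Variable R : realType.
Implicit Types (p q m n l : nat) (f W : R -> R -> R)
  (F S : R -> R -> 'cV[R]_3).

Definition bernstein (k i : nat) (t : R) : R :=
  'C(k, i)%:R * t ^+ i * (1 - t) ^+ (k - i).

Definition tensor_bernstein m n (D : 'M[R]_(m.+1, n.+1)) (xi eta : R) : R :=
  \sum_(r < m.+1) \sum_(s < n.+1)
    D r s * (bernstein m r xi * bernstein n s eta).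

Definition tensor_bernstein_vec p q
    (C : 'I_p.+1 -> 'I_q.+1 -> 'cV[R]_3) (xi eta : R) : 'cV[R]_3 :=
  \sum_(i < p.+1) \sum_(j < q.+1)
    (bernstein p i xi * bernstein q j eta) *: C i j.

(* An identity on all of R^2; for a polynomial f this is the same as the
   identity on [0,1]^2. *)
Definition bernstein_representation m n f (D : 'M[R]_(m.+1, n.+1)) : Prop :=
  forall xi eta, f xi eta = tensor_bernstein D xi eta.

Definition partial_xi f (xi eta : R) : R := derive1 (fun t => f t eta) xi.
Definition partial_eta f (xi eta : R) : R := derive1 (fun t => f xi t) eta.

Definition vec_partial_xi S (xi eta : R) : 'cV[R]_3 :=
  \col_k partial_xi (fun x y => S x y k 0) xi eta.
Definition vec_partial_eta S (xi eta : R) : 'cV[R]_3 :=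
  \col_k partial_eta (fun x y => S x y k 0) xi eta.

(* F and W are defined on R^2, and so is this quotient. For positive weights W
   is positive on a neighbourhood of [0,1]^2, so at boundary points the
   (two-sided) partial derivatives of the quotient are the one-sided ones of
   the patch. *)
Definition rational_patch F W (xi eta : R) : 'cV[R]_3 :=
  (W xi eta)^-1 *: F xi eta.

Definition jacobian_matrix S (xi eta : R) : 'M[R]_(3, 2) :=
  row_mx (vec_partial_xi S xi eta) (vec_partial_eta S xi eta).

Definition in_unit_square (xi eta : R) : Prop :=
  0 <= xi <= 1 /\ 0 <= eta <= 1.

Definition regular_on_unit_square S : Prop :=
  forall xi eta, in_unit_square xi eta -> \rank (jacobian_matrix S xi eta) = 2%N.

Definition dot (u v : 'cV[R]_3) : R := \sum_k u k 0 * v k 0.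

Definition numU F W (xi eta : R) : 'cV[R]_3 :=
  W xi eta *: vec_partial_xi F xi eta - partial_xi W xi eta *: F xi eta.
Definition numV F W (xi eta : R) : 'cV[R]_3 :=
  W xi eta *: vec_partial_eta F xi eta - partial_eta W xi eta *: F xi eta.

Definition gram_numerator F W (xi eta : R) : R :=
  let U := numU F W xi eta in let V := numV F W xi eta in
  dot U U * dot V V - dot U V ^+ 2.

Definition restriction f (a b c d xi eta : R) : R :=
  f (a + (b - a) * xi) (c + (d - c) * eta).

Definition dyadic_restriction f l (i j : 'I_(2 ^ l)) : R -> R -> R :=
  restriction f (i%:R / 2 ^+ l) (i.+1%:R / 2 ^+ l)
                (j%:R / 2 ^+ l) (j.+1%:R / 2 ^+ l).

End Bezier.

(* Main.v *)
Require Import Defs.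
From mathcomp Require Import all_boot all_order all_algebra.
From mathcomp Require Import all_classical all_reals all_analysis.
From mathcomp Require Import ring lra zify.
Import Order.TTheory GRing.Theory Num.Theory.
Local Open Scope ring_scope.

(** The Bernstein coefficients of a polynomial on a small square are close to
    its value at a corner of that square, so they inherit the lower bound rho.

    In one variable, expand [u] of degree at most m at [a]:
    u(a + h x) = sum_j c_j h^j x^j, where c_j is the j-th Taylor coefficient.
    Since x^j = sum_r 'C(r, j) / 'C(m, j) B_r^m(x) ([exprn_bernstein]), the r-th
    Bernstein coefficient of u on [a, a + h] is
    sum_j c_j h^j 'C(r, j) / 'C(m, j), named [bernstein_coef] below.  Its j = 0
    term is u(a), and every other term has a factor h, a ratio of binomials at
    most 1, and a Taylor coefficient that is bounded on [0, 1].  Hence it is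
    within K h of u(a), with K independent of a, h and r
    ([bernstein_coef_near]).

    A polynomial in two variables is a finite sum of products u(x) v(y), and
    its Bernstein coefficients are the sums of the products of those of u and
    v.  So on a square of side h with lower left corner (a, c), they too differ
    from N(a, c) by at most K h ([tensor_coef_near]).  As N(a, c) >= rho, all
    of them are positive once h < rho / (K + 1)
    ([restriction_bernstein_gt0]), and a dyadic square of level l has side
    2^-l.

    Two further points are needed.  The bi-degree of the Gram numerator has to
    be at most (8p - 2, 8q - 2): U has one xi-derivative in each term and V one
    eta-derivative, and each derivative lowers the degree by one
    ([bidegree_le_gram_numerator]).  The Bernstein coefficients are unique
    because the Bernstein polynomials are linearly independent
    ([bernstein_free]). *)

(** * Polynomial functions of bounded bi-degree *)

Section Bidegree.
Set Implicit Arguments.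
Unset Strict Implicit.
Context {R : realType}.
Implicit Types (f g : R -> R -> R) (m n : nat).

(** Finite sums of products of univariate polynomials are used here, rather than
    bivariate polynomials, because this form is symmetric in the two variables
    and reduces Bernstein coefficients to the univariate case. *)
Definition bidegree_le m n f : Prop :=
  exists2 s : seq ({poly R} * {poly R}),
    all (fun u : {poly R} * {poly R} =>
      (size u.1 <= m.+1)%N && (size u.2 <= n.+1)%N) s &
    forall x y, f x y = \sum_(u <- s) u.1.[x] * u.2.[y].

Lemma bidegree_le_eq m n f g :
  (forall x y, f x y = g x y) -> bidegree_le m n g -> bidegree_le m n f.
Proof. by move=> fg [s sP gE]; exists s => // x y; rewrite fg. Qed.

Lemma bidegree_le_widen m n m' n' f : (m <= m')%N -> (n <= n')%N ->
  bidegree_le m n f -> bidegree_le m' n' f.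
Proof.
move=> mm' nn' [s sP fE]; exists s => //; apply: sub_all sP => u /andP[u1 u2].
by rewrite (leq_trans u1) ?ltnS // (leq_trans u2).
Qed.

Lemma bidegree_le_swap m n f :
  bidegree_le m n f -> bidegree_le n m (fun x y => f y x).
Proof.
move=> [s sP fE]; exists [seq (u.2, u.1) | u <- s].
  by rewrite all_map; apply: sub_all sP => u; rewrite /= andbC.
by move=> x y; rewrite fE big_map; apply: eq_bigr => u _; rewrite mulrC.
Qed.

Lemma bidegree_leZ m n a f :
  bidegree_le m n f -> bidegree_le m n (fun x y => a * f x y).
Proof.
move=> [s sP fE]; exists [seq (a *: u.1, u.2) | u <- s].
  rewrite all_map; apply: sub_all sP => u /andP[u1 u2] /=.
  by rewrite (leq_trans (size_scale_leq _ _)).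
move=> x y; rewrite fE big_map mulr_sumr.
by apply: eq_bigr => u _; rewrite hornerZ mulrA.
Qed.

Lemma bidegree_leD m n f g : bidegree_le m n f -> bidegree_le m n g ->
  bidegree_le m n (fun x y => f x y + g x y).
Proof.
move=> [s sP fE] [t tP gE]; exists (s ++ t); first by rewrite all_cat sP.
by move=> x y; rewrite fE gE big_cat.
Qed.

Lemma bidegree_leB m n f g : bidegree_le m n f -> bidegree_le m n g ->
  bidegree_le m n (fun x y => f x y - g x y).
Proof.
move=> fP gP; apply: bidegree_le_eq (bidegree_leD fP (bidegree_leZ (-1) gP)).
by move=> x y; rewrite mulN1r.
Qed.

Lemma bidegree_le_sum m n (I : Type) (r : seq I) (F : I -> R -> R -> R) :
  (forall i, bidegree_le m n (F i)) ->
  bidegree_le m n (fun x y => \sum_(i <- r) F i x y).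
Proof.
move=> FP; elim: r => [|i r IH].
  by exists [::] => // x y; rewrite !big_nil.
apply: bidegree_le_eq (bidegree_leD (FP i) IH).
by move=> x y; rewrite big_cons.
Qed.

Lemma size_mul_le (u v : {poly R}) m n : (size u <= m.+1)%N ->
  (size v <= n.+1)%N -> (size (u * v)%R <= (m + n).+1)%N.
Proof. by move=> um vn; apply: (leq_trans (size_polyMleq _ _)); lia. Qed.

Lemma bidegree_leM m n m' n' f g : bidegree_le m n f -> bidegree_le m' n' g ->
  bidegree_le (m + m') (n + n') (fun x y => f x y * g x y).
Proof.
move=> [s sP fE] [t tP gE].
exists [seq (u.1 * v.1, u.2 * v.2) | u <- s, v <- t].
  apply/allP => _ /allpairsP[[u v] /= [us vt ->]] /=.
  have /andP[u1 u2] := allP sP _ us; have /andP[v1 v2] := allP tP _ vt.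
  by rewrite !size_mul_le.
move=> x y; rewrite fE gE big_allpairs_dep big_distrlr /=.
by apply: eq_bigr => u _; apply: eq_bigr => v _; rewrite !hornerM mulrACA.
Qed.

Lemma size_deriv_le (u : {poly R}) m :
  (size u <= m.+1)%N -> (size u^`() <= m.-1.+1)%N.
Proof.
move=> um; have [->|u0] := eqVneq u 0; first by rewrite deriv0 size_poly0.
by have := lt_size_deriv u0; lia.
Qed.

(** For fixed [y] the function is a univariate polynomial, so its analytic
    derivative is the formal one, taken on the first factor of each product. *)
Lemma bidegree_le_partial_xi m n f :
  bidegree_le m n f -> bidegree_le m.-1 n (partial_xi f).
Proof.
move=> [s sP fE]; exists [seq (u.1^`(), u.2) | u <- s].
  rewrite all_map; apply: sub_all sP => u /andP[u1 u2] /=.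
  by rewrite size_deriv_le.
move=> x y; rewrite /partial_xi.
have -> : (fun t => f t y) = horner (\sum_(u <- s) u.2.[y] *: u.1).
  apply/funext => t; rewrite fE horner_sum.
  by apply: eq_bigr => u _; rewrite hornerZ mulrC.
rewrite -derivE raddf_sum horner_sum big_map.
by apply: eq_bigr => u _; rewrite /= derivZ hornerZ mulrC.
Qed.

Lemma bidegree_le_partial_eta m n f :
  bidegree_le m n f -> bidegree_le m n.-1 (partial_eta f).
Proof.
by move=> /bidegree_le_swap/bidegree_le_partial_xi/bidegree_le_swap.
Qed.

Definition bernstein_poly k i : {poly R} :=
  'C(k, i)%:R *: ('X ^+ i * (1 - 'X) ^+ (k - i)).

Lemma horner_bernstein_poly k i t : (bernstein_poly k i).[t] = bernstein k i t.
Proof. by rewrite /bernstein /bernstein_poly !hornerE. Qed.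

Lemma size_bernstein_poly k i :
  (i <= k)%N -> (size (bernstein_poly k i) <= k.+1)%N.
Proof.
move=> ik; apply: (leq_trans (size_scale_leq _ _)).
rewrite -[X in (_ <= X.+1)%N](subnKC ik) size_mul_le // ?size_polyXn //.
apply: (leq_trans (size_poly_exp_leq _ _)).
suff -> : size (1 - 'X : {poly R}) = 2 by rewrite mul1n.
by rewrite -opprB size_polyN -polyC1 size_XsubC.
Qed.

Lemma bidegree_le_tensor_bernstein m n (D : 'M[R]_(m.+1, n.+1)) :
  bidegree_le m n (tensor_bernstein D).
Proof.
apply: bidegree_le_sum => r; apply: bidegree_le_sum => s.
apply: bidegree_leZ; exists [:: (bernstein_poly m r, bernstein_poly n s)].
  by rewrite /= !size_bernstein_poly // -ltnS.
by move=> x y; rewrite big_seq1 /= !horner_bernstein_poly.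
Qed.

Lemma bidegree_le_dot m n m' n' (U V : R -> R -> 'cV[R]_3) :
  (forall k, bidegree_le m n (fun x y => U x y k 0)) ->
  (forall k, bidegree_le m' n' (fun x y => V x y k 0)) ->
  bidegree_le (m + m') (n + n') (fun x y => dot (U x y) (V x y)).
Proof. by move=> UP VP; apply: bidegree_le_sum => k; apply: bidegree_leM. Qed.

(** The [xi]-degrees of [U] and [V] are at most [p.-1 + p] and [p + p], and each
    term of the Gram determinant has two factors [U] and two factors [V], whence
    [8 * p - 2].  For [p = 0] the predecessor and the subtraction both truncate
    to 0, so this case agrees with the general one. *)
Lemma bidegree_le_gram_numerator p q (F : R -> R -> 'cV[R]_3) W :
  (forall k, bidegree_le p q (fun x y => F x y k 0)) -> bidegree_le p q W ->
  bidegree_le (8 * p - 2) (8 * q - 2) (gram_numerator F W).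
Proof.
move=> FP WP.
have UP k : bidegree_le (p.-1 + p) (q + q) (fun x y => numU F W x y k 0).
  have U1 := bidegree_leM (bidegree_le_partial_xi (FP k)) WP.
  have U2 := bidegree_leM (bidegree_le_partial_xi WP) (FP k).
  apply: bidegree_le_eq (bidegree_leB U1 U2) => x y.
  by rewrite /numU /vec_partial_xi !mxE [X in X - _]mulrC.
have VP k : bidegree_le (p + p) (q.-1 + q) (fun x y => numV F W x y k 0).
  have V1 := bidegree_leM (bidegree_le_partial_eta (FP k)) WP.
  have V2 := bidegree_leM (bidegree_le_partial_eta WP) (FP k).
  apply: bidegree_le_eq (bidegree_leB V1 V2) => x y.
  by rewrite /numV /vec_partial_eta !mxE [X in X - _]mulrC.
have UU := bidegree_le_dot UP UP.
have VV := bidegree_le_dot VP VP.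
have UV := bidegree_le_dot UP VP.
apply: bidegree_leB.
  by apply: bidegree_le_widen (bidegree_leM UU VV); lia.
by apply: bidegree_le_widen (bidegree_leM UV UV); lia.
Qed.

End Bidegree.

(** * Univariate Bernstein coefficients on an interval *)

Section Coefficients.
Set Implicit Arguments.
Unset Strict Implicit.
Context {R : realType}.
Implicit Types (m n r j : nat) (u : {poly R}).

(** Both sides are the multinomial coefficient m! / (j! i! (m - j - i)!). *)
Lemma bin_trinomial m j i : (j + i <= m)%N ->
  ('C(m, j + i) * 'C(j + i, j) = 'C(m, j) * 'C(m - j, i))%N.
Proof.
move=> jim; have jm : (j <= m)%N by lia.
have im : (i <= m - j)%N by lia.
have f1 := bin_fact jim; have f2 := bin_fact (leq_addr i j).
have f3 := bin_fact jm; have f4 := bin_fact im.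
have e : (m - j - i = m - (j + i))%N by lia.
rewrite e in f4; rewrite addKn in f2.
apply/eqP; rewrite -(eqn_pmul2r (fact_gt0 j)) -(eqn_pmul2r (fact_gt0 i)).
rewrite -(eqn_pmul2r (fact_gt0 (m - (j + i)))); apply/eqP.
transitivity m`!.
  by rewrite -f1 -f2; ring.
by rewrite -f3 -f4; ring.
Qed.

(** Multiply [x ^+ j] by 1 = ((1 - x) + x) ^+ (m - j) and expand by the binomial
    theorem. *)
Lemma exprn_bernstein m j (x : R) : (j <= m)%N ->
  x ^+ j = \sum_(r < m.+1) 'C(r, j)%:R / 'C(m, j)%:R * bernstein m r x.
Proof.
move=> jm.
pose G r := 'C(r, j)%:R / 'C(m, j)%:R * bernstein m r x : R.
have C0 : ('C(m, j)%:R : R) != 0 by rewrite pnatr_eq0 -lt0n bin_gt0.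
rewrite -(big_mkord xpredT G) (big_cat_nat (n := j)) ?leqW //=.
(* The terms of index r < j vanish. *)
rewrite [X in X + _]big_nat_cond [X in X + _]big1 ?add0r; last first.
  by move=> i; rewrite andbT => /andP[_ ij]; rewrite /G bin_small // !mul0r.
rewrite -[X in index_iota X _]add0n big_addn big_mkord subSn //.
rewrite -[LHS]mulr1 -(expr1n R (m - j)) -{1}[1](subrK x) exprDn mulr_sumr.
apply: eq_bigr => i _; have im : (j + i <= m)%N by have := ltn_ord i; lia.
have := congr1 (fun k => k%:R : R) (bin_trinomial im); rewrite !natrM => E.
rewrite /G /bernstein (addnC i j) subnDA -mulr_natr exprD.
by apply: (mulfI C0); field: E.
Qed.

(** The coefficients of [x |-> u.[a + h * x]] on the Bernstein basis of degree
    [m]: its coefficient on ['X^j] is [u^`N(j).[a] * h ^+ j], and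
    [exprn_bernstein] gives the Bernstein coefficients of ['X^j]. *)
Definition bernstein_coef m u (a h : R) r : R :=
  \sum_(j < m.+1) u^`N(j).[a] * h ^+ j * ('C(r, j)%:R / 'C(m, j)%:R).

Lemma bernstein_coefP m u a h x : (size u <= m.+1)%N ->
  u.[a + h * x] = \sum_(r < m.+1) bernstein_coef m u a h r * bernstein m r x.
Proof.
move=> um; rewrite (nderiv_taylor_wide (mulrC _ _) um).
under [RHS]eq_bigr do rewrite /bernstein_coef mulr_suml.
rewrite exchange_big; apply: eq_bigr => j _ /=.
rewrite exprMn (@exprn_bernstein m j x) -1?ltnS // mulrA mulr_sumr.
by apply: eq_bigr => r _; rewrite mulrA.
Qed.

Lemma poly_unit_bound u :
  exists2 B : R, 0 <= B & forall a : R, 0 <= a <= 1 -> `|u.[a]| <= B.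
Proof.
have [B BP] := poly_itv_bound u 0 1; exists B => //.
by apply: le_trans (BP 0 _); rewrite ?normr_ge0 ?lexx ?ler01.
Qed.

(** The term [j = 0] of [bernstein_coef] is [u.[a]]; all others have a factor
    [h], and the Taylor coefficients are bounded on the unit interval. *)
Lemma bernstein_coef_near m u : exists2 K : R, 0 <= K & forall r (a h : R),
  (r <= m)%N -> 0 <= a <= 1 -> 0 <= h <= 1 ->
  `|bernstein_coef m u a h r - u.[a]| <= K * h.
Proof.
have /choice[B BP] : forall j, exists B : R, 0 <= B /\
    forall a : R, 0 <= a <= 1 -> `|u^`N(j).[a]| <= B.
  by move=> j; have [B ? ?] := poly_unit_bound u^`N(j); exists B.
exists (\sum_(j < m) B j.+1); first by apply: sumr_ge0 => j _; case: (BP j.+1).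
move=> r a h rm a01 /andP[h0 h1].
rewrite /bernstein_coef big_ord_recl /= nderivn0 expr0 !bin0 divr1 !mulr1.
rewrite addrC addKr mulr_suml (le_trans (ler_norm_sum _ _ _)) //.
apply: ler_sum => j _; rewrite /bump /= add1n !normrM.
have [_ /(_ a a01) uB] := BP j.+1.
have hj : `|h ^+ j.+1| <= h.
  by rewrite ger0_norm ?exprn_ge0 // exprS ler_piMr // exprn_ile1.
have Cj : `|'C(r, j.+1)%:R| * `|'C(m, j.+1)%:R^-1| <= 1 :> R.
  rewrite -normrM ger0_norm ?divr_ge0 // ler_pdivrMr ?ltr0n ?bin_gt0 //.
  by rewrite mul1r ler_nat leq_bin2l.
by rewrite -[leRHS]mulr1 !ler_pM ?mulr_ge0 // mulr_ge0.
Qed.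

(** * Linear independence of the Bernstein polynomials *)

(** Substituting x = t / (1 + t) turns the combination of Bernstein polynomials,
    up to the factor (1 + t) ^+ m, into a polynomial in [t] with coefficients
    c_r 'C(m, r).  It vanishes at all natural numbers [t], so it is zero. *)
Lemma bernstein_free m (c : 'I_m.+1 -> R) :
  (forall x, \sum_(r < m.+1) c r * bernstein m r x = 0) ->
  forall r : 'I_m.+1, c r = 0.
Proof.
move=> c0.
pose P : {poly R} := \poly_(i < m.+1) (c (inord i) * 'C(m, i)%:R).
have P0 : P = 0.
  apply: (@roots_geq_poly_eq0 _ _ [seq k%:R | k <- iota 0 m.+1]).
  - rewrite all_map; apply/allP => k _ /=; apply/rootP.
    have k1 : (1 + k%:R : R) != 0 by rewrite nat1r pnatr_eq0.
    rewrite horner_poly; transitivity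
      ((1 + k%:R) ^+ m * \sum_(r < m.+1) c r * bernstein m r (k%:R / (1 + k%:R))).
      rewrite mulr_sumr; apply: eq_bigr => r _; rewrite inord_val /bernstein.
      have -> : 1 - k%:R / (1 + k%:R) = (1 + k%:R)^-1 :> R by field.
      have rm : (r <= m)%N by rewrite -ltnS.
      rewrite -[in (1 + k%:R) ^+ m](subnKC rm) exprD exprMn !exprVn.
      by field; rewrite !expf_neq0.
    by rewrite c0 mulr0.
  - by rewrite map_inj_uniq ?iota_uniq //; apply: mulrIn; rewrite oner_neq0.
  - by rewrite size_map size_iota size_poly.
move=> r; have := congr1 (fun p : {poly R} => p`_r) P0.
rewrite coef_poly ltn_ord inord_val coef0 => /eqP.
by rewrite mulf_eq0 pnatr_eq0 -leqn0 leqNgt bin_gt0 -ltnS ltn_ord orbF => /eqP.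
Qed.

(** Linear independence is applied in each variable in turn. *)
Lemma bernstein_representation_inj m n f (D D' : 'M[R]_(m.+1, n.+1)) :
  bernstein_representation f D -> bernstein_representation f D' -> D = D'.
Proof.
move=> fD fD'; apply/matrixP => r s; apply/eqP; rewrite -subr_eq0; apply/eqP.
move: s; apply: bernstein_free => y; move: r; apply: bernstein_free => x.
apply: etrans (subrr (f x y)); rewrite {1}fD fD' -sumrB.
apply: eq_bigr => r _; rewrite mulr_suml -sumrB; apply: eq_bigr => s _; ring.
Qed.

(** * Bernstein coefficients on a square *)

(** The restriction of [u.[x] * v.[y]] has the products of the univariate
    coefficients as its Bernstein coefficients, and restriction is linear. *)
Lemma bernstein_representation_restriction m n f
    (s : seq ({poly R} * {poly R})) a h c k :
  all (fun u : {poly R} * {poly R} =>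
    (size u.1 <= m.+1)%N && (size u.2 <= n.+1)%N) s ->
  (forall x y, f x y = \sum_(u <- s) u.1.[x] * u.2.[y]) ->
  bernstein_representation (restriction f a (a + h) c (c + k))
    (\matrix_(r < m.+1, t < n.+1)
       \sum_(u <- s) bernstein_coef m u.1 a h r * bernstein_coef n u.2 c k t).
Proof.
move=> sP fE x y.
rewrite /restriction (addrC a h) (addrC c k) !addrK fE /tensor_bernstein.
under [RHS]eq_bigr do under eq_bigr do rewrite mxE mulr_suml.
under [RHS]eq_bigr do rewrite exchange_big /=.
rewrite [RHS]exchange_big /= big_seq [RHS]big_seq; apply: eq_bigr => u us.
have /andP[u1 u2] := allP sP _ us.
rewrite (bernstein_coefP _ _ _ u1) (bernstein_coefP _ _ _ u2) big_distrlr /=.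
by apply: eq_bigr => r _; apply: eq_bigr => t _; rewrite mulrACA.
Qed.

(** The estimate for a product comes from
    b1 b2 - u v = (b1 - u) b2 + u (b2 - v), where [b2] is bounded by a bound of
    [v] plus the error made in [v]. *)
Lemma tensor_coef_near m n (s : seq ({poly R} * {poly R})) :
  exists2 K : R, 0 <= K & forall r t (a c h : R), (r <= m)%N -> (t <= n)%N ->
    0 <= a <= 1 -> 0 <= c <= 1 -> 0 <= h <= 1 ->
  `|\sum_(u <- s) bernstein_coef m u.1 a h r * bernstein_coef n u.2 c h t
    - \sum_(u <- s) u.1.[a] * u.2.[c]| <= K * h.
Proof.
elim: s => [|[u v] s [K K0 KP]].
  by exists 0 => // *; rewrite !big_nil subrr normr0 mul0r.
have [Bu Bu0 BuP] := poly_unit_bound u; have [Bv Bv0 BvP] := poly_unit_bound v.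
have [Ku Ku0 KuP] := bernstein_coef_near m u.
have [Kv Kv0 KvP] := bernstein_coef_near n v.
exists (Ku * (Bv + Kv) + Bu * Kv + K).
  by rewrite !addr_ge0 // mulr_ge0 ?addr_ge0.
move=> r t a c h rm tn a01 c01 h01; rewrite !big_cons /=.
move: (KP r t a c h rm tn a01 c01 h01).
move: (KuP r a h rm a01 h01) (KvP t c h tn c01 h01) (BuP a a01) (BvP c c01).
move: (bernstein_coef _ u _ _ _) (bernstein_coef _ v _ _ _) => b1 b2.
move: (\sum_(_ <- _) _) (\sum_(_ <- _) _) => S2 S1 E1 E2 Ba Bc ES.
have -> : b1 * b2 + S1 - (u.[a] * v.[c] + S2) =
  (b1 - u.[a]) * b2 + u.[a] * (b2 - v.[c]) + (S1 - S2) by ring.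
have /andP[h0 h1] := h01.
have b2B : `|b2| <= Bv + Kv.
  rewrite -(subrKC v.[c] b2) (le_trans (ler_normD _ _)) // lerD //.
  by rewrite (le_trans E2) // ler_piMr.
rewrite [leRHS]mulrDl [X in _ <= X + _]mulrDl.
rewrite (le_trans (ler_normD _ _)) // lerD //.
rewrite (le_trans (ler_normD _ _)) // !normrM lerD //.
  by rewrite mulrAC ler_pM.
by rewrite -mulrA ler_pM.
Qed.

Lemma bidegree_le_bernstein m n f : bidegree_le m n f ->
  exists! D : 'M[R]_(m.+1, n.+1), bernstein_representation f D.
Proof.
move=> [s sP fE].
have := bernstein_representation_restriction 0 1 0 1 sP fE.
set D := \matrix_(_, _) _ => restrD.
have fD : bernstein_representation f D.
  by move=> x y; rewrite -restrD /restriction !add0r !subr0 !mul1r.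
by exists D; split => // D'; apply: bernstein_representation_inj.
Qed.

(** The threshold [d] depends only on [rho] and the constant of
    [tensor_coef_near], hence works for all positions of the square at once. *)
Lemma restriction_bernstein_gt0 m n f (rho : R) : bidegree_le m n f -> 0 < rho ->
  (forall x y : R, in_unit_square x y -> rho <= f x y) ->
  exists2 d : R, 0 < d & forall a c h : R,
    0 <= a <= 1 -> 0 <= c <= 1 -> 0 <= h <= 1 -> h < d ->
    exists D : 'M[R]_(m.+1, n.+1),
      unique (bernstein_representation
                (restriction f a (a + h) c (c + h))) D /\
      forall (r : 'I_m.+1) (s : 'I_n.+1), 0 < D r s.
Proof.
move=> [s sP fE] rho0 frho; have [K K0 KP] := tensor_coef_near m n s.
have K1 : 0 < K + 1 by rewrite ltr_wpDl.
(* K + 1 rather than K, because K may be 0. *)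
exists (rho / (K + 1)); first exact: divr_gt0.
move=> a c h a01 c01 h01 hd.
have fD := bernstein_representation_restriction a h c h sP fE.
eexists; split.
  by split; [exact: fD | move=> D'; apply: bernstein_representation_inj fD].
move=> r t; rewrite mxE.
have := KP r t a c h (ltn_ord r) (ltn_ord t) a01 c01 h01.
rewrite -fE; have := frho a c (conj a01 c01).
move: hd; rewrite ltr_pdivlMr // => hd ?; rewrite ler_norml => /andP[? _].
have /andP[? _] := h01; lra.
Qed.

End Coefficients.

(** * Dyadic squares *)

Theorem theorem3p9 (R : realType) (p q : nat)
    (C : 'I_p.+1 -> 'I_q.+1 -> 'cV[R]_3) (w : 'M[R]_(p.+1, q.+1)) (rho : R) :
  let F := tensor_bernstein_vec C in
  let W := tensor_bernstein w in
  let N := gram_numerator F W in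
  let m := (8 * p - 2)%N in
  let n := (8 * q - 2)%N in
  (forall i j, 0 < w i j) ->
  regular_on_unit_square (rational_patch F W) ->
  0 < rho ->
  (forall xi eta : R, in_unit_square xi eta -> rho <= N xi eta) ->
  (exists! D : 'M[R]_(m.+1, n.+1), bernstein_representation N D) /\
  exists l0 : nat, forall l : nat, (l0 <= l)%N ->
    forall i j : 'I_(2 ^ l),
      exists Dt : 'M[R]_(m.+1, n.+1),
        unique (bernstein_representation (dyadic_restriction N i j)) Dt /\
        forall (r : 'I_m.+1) (s : 'I_n.+1), 0 < Dt r s.
Proof.
move=> F W N m n _ _ rho0 Nrho.
have NP : bidegree_le m n N.
  apply: bidegree_le_gram_numerator => [k|]; last first.
    exact: bidegree_le_tensor_bernstein.
  apply: bidegree_le_eq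
    (bidegree_le_tensor_bernstein (\matrix_(i, j) C i j k 0)) => x y.
  rewrite summxE; apply: eq_bigr => i _; rewrite summxE; apply: eq_bigr => j _.
  by rewrite !mxE mulrC.
split; first exact: bidegree_le_bernstein.
have [d d0 dP] := restriction_bernstein_gt0 NP rho0 Nrho.
(* 2^l > l > 1 / d as soon as l > truncn (1 / d). *)
exists (Num.truncn d^-1).+1 => l l0l i j.
have pow0 : 0 < 2 ^+ l :> R by rewrite exprn_gt0.
have dyadic01 (k : 'I_(2 ^ l)) : 0 <= (k%:R / 2 ^+ l : R) <= 1.
  rewrite divr_ge0 ?ler0n ?(ltW pow0) //=.
  by rewrite ler_pdivrMr // mul1r -natrX ler_nat ltnW.
have dyadicS (k : nat) : k.+1%:R / 2 ^+ l = k%:R / 2 ^+ l + (2 ^+ l)^-1 :> R.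
  by rewrite -natr1 mulrDl mul1r.
rewrite /dyadic_restriction !dyadicS; apply: dP => //.
  by rewrite invr_ge0 ltW //= invf_le1 // exprn_ege1 // ler1n.
rewrite invf_plt ?posrE // (lt_trans (truncnS_gt _)) //.
by rewrite -natrX ltr_nat (leq_ltn_trans l0l) // ltn_expl.
Qed.
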